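(* Let $X$ be a random variable on a finite set $\mathcal{X}$ inducing a stationary memoryless source, let $\hat{\mathcal{X}}$ be a finite set, and let $c:\mathcal{X}\times\hat{\mathcal{X}}\to[0,\infty)$ be an arbitrary function inducing the additive cost $c_n(x^n,\hat x^n)=\frac1n\sum_{i=1}^nc(x_i,\hat x_i)$. When $Y=X$, for any integer $n\ge1$ and any real $\epsilon\ge0$ the non-asymptotic minimum average cost satisfies $$C_{\rm a}^{*}(n,\epsilon)=\min_{\hat X:\ I(X;\hat X)\le\frac{\epsilon}{n}}\mathrm{E}[c(X,\hat X)],$$ where the minimum is over all random variables $\hat X$ on $\hat{\mathcal{X}}$, jointly distributed with $X$, such that $I(X;\hat X)\le\epsilon/n$.
   Context: $\mathcal{X},\hat{\mathcal{X}}$ are finite nonempty sets; $I(\cdot;\cdot)$ is mutual information (natural logarithm). The stationary memoryless source induced by $X$: $X_1,X_2,\dots$ are independent copies of $X$, $X^n=(X_1,\dots,X_n)$; the condition $Y=X$ means $Y^n=X^n$. A stochastic encoder $f_n:\mathcal{X}^n\to\hat{\mathcal{X}}^n$ is a random map, i.e. given by a conditional probability distribution on $\hat{\mathcal{X}}^n$ given $x^n\in\mathcal{X}^n$. For an integer $n\ge1$ and reals $\Gamma,\epsilon\ge0$, $\Gamma$ is $(n,\epsilon)$-strongly achievable in the sense of the average cost if there exists a stochastic encoder $f_n$ with $I(Y^n;f_n(X^n))\le\epsilon$ and $\mathrm{E}[c_n(X^n,f_n(X^n))]\le\Gamma$. Define $C_{\rm a}^*(n,\epsilon)=\inf\{\Gamma\ge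 0:\Gamma\text{ is }(n,\epsilon)\text{-strongly achievable in the sense of the average cost}\}$. *)

(* Defs.v *)
From HB Require Import structures.
From mathcomp Require Import all_boot all_order all_algebra.
From mathcomp Require Import all_classical all_reals all_analysis.

Set Implicit Arguments.
Unset Strict Implicit.
Unset Printing Implicit Defensive.

Import Order.TTheory GRing.Theory Num.Theory.
Local Open Scope ring_scope.
Local Open Scope classical_set_scope.

Record fdist (R : realType) (A : finType) := FDist {
  pmf :> A -> R ;
  pmf_ge0 : forall a, 0 <= pmf a ;
  pmf_sum1 : \sum_a pmf a = 1 }.

Section FiniteDistributions.
Variable R : realType.
Implicit Types A B W : finType.

Lemma fdistmap_ge0 W A (P : fdist R W) (U : W -> A) a :
  0 <= \sum_(w | U w == a) P w.
Proof. by apply: sumr_ge0 => w _; exact: pmf_ge0. Qed.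

Lemma fdistmap_sum1 W A (P : fdist R W) (U : W -> A) :
  \sum_a \sum_(w | U w == a) P w = 1.
Proof. by rewrite -(pmf_sum1 P) [RHS](partition_big U predT). Qed.

(* The law of the random variable [U] on the finite probability space [(W, P)]. *)
Definition fdistmap W A (P : fdist R W) (U : W -> A) : fdist R A :=
  FDist (fdistmap_ge0 P U) (fdistmap_sum1 P U).

Lemma fdistjoint_ge0 A B (P : fdist R A) (K : A -> fdist R B) (ab : A * B) :
  0 <= P ab.1 * K ab.1 ab.2.
Proof. by apply: mulr_ge0; exact: pmf_ge0. Qed.

Lemma fdistjoint_sum1 A B (P : fdist R A) (K : A -> fdist R B) :
  \sum_(ab : A * B) P ab.1 * K ab.1 ab.2 = 1.
Proof.
rewrite -(pair_bigA _ (fun a b => P a * K a b)) /= -(pmf_sum1 P).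
by apply: eq_bigr => a _; rewrite -mulr_sumr pmf_sum1 mulr1.
Qed.

(* The joint law of an input with law [P] and its image under the random map
   given by the conditional distributions [K]. *)
Definition fdistjoint A B (P : fdist R A) (K : A -> fdist R B) :
    fdist R (A * B)%type :=
  FDist (fdistjoint_ge0 P K) (fdistjoint_sum1 P K).

Lemma fdistiid_ge0 A (P : fdist R A) n (x : {ffun 'I_n -> A}) :
  0 <= \prod_(i < n) P (x i).
Proof. by apply: prodr_ge0 => i _; exact: pmf_ge0. Qed.

Lemma fdistiid_sum1 A (P : fdist R A) n :
  \sum_(x : {ffun 'I_n -> A}) \prod_(i < n) P (x i) = 1.
Proof.
rewrite -(bigA_distr_bigA (fun (_ : 'I_n) a => P a)).
by apply: big1 => i _; exact: pmf_sum1.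
Qed.

(* The law of [n] independent copies. *)
Definition fdistiid A (P : fdist R A) n : fdist R {ffun 'I_n -> A} :=
  FDist (@fdistiid_ge0 A P n) (@fdistiid_sum1 A P n).

Definition expect W (P : fdist R W) (g : W -> R) : R := \sum_w P w * g w.

(* I(U; V) in nats. The terms of probability zero vanish thanks to the factor
   in front of the logarithm, which implements 0 ln 0 = 0. *)
Definition mutual_info W A B (P : fdist R W) (U : W -> A) (V : W -> B) : R :=
  let PU := fdistmap P U in
  let PV := fdistmap P V in
  let PUV := fdistmap P (fun w => (U w, V w)) in
  \sum_(ab : A * B) PUV ab * ln (PUV ab / (PU ab.1 * PV ab.2)).

End FiniteDistributions.

Section Cost.
Variables (R : realType) (X Y Xhat : finType).

Definition additive_cost (c : X -> Xhat -> R) n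
    (x : {ffun 'I_n -> X}) (xh : {ffun 'I_n -> Xhat}) : R :=
  n%:R^-1 * \sum_(i < n) c (x i) (xh i).

Definition encoder n := {ffun 'I_n -> X} -> fdist R {ffun 'I_n -> Xhat}.

(* [PXY] is the law of one letter (X, Y) of the memoryless source. The sample
   space is that of the n source letters together with the encoder output;
   the encoder only sees the X-components. *)
Definition avg_strongly_achievable (PXY : fdist R (X * Y)%type)
    (c : X -> Xhat -> R) (n : nat) (eps Gamma : R) : Prop :=
  exists f : encoder n,
    let Xn (s : {ffun 'I_n -> (X * Y)%type}) := [ffun i => (s i).1] in
    let Yn (s : {ffun 'I_n -> (X * Y)%type}) := [ffun i => (s i).2] in
    let J := fdistjoint (fdistiid PXY n) (fun s => f (Xn s)) in
    mutual_info J (fun w => Yn w.1) (fun w => w.2) <= eps /\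
    expect J (fun w => additive_cost c (Xn w.1) w.2) <= Gamma.

(* Taken in \bar R so that the infimum of the empty set is +oo. *)
Definition Ca_star (PXY : fdist R (X * Y)%type) (c : X -> Xhat -> R)
    (n : nat) (eps : R) : \bar R :=
  ereal_inf [set Gamma%:E | Gamma in
    [set Gamma : R | 0 <= Gamma /\ avg_strongly_achievable PXY c n eps Gamma]].

End Cost.

(* The law of (X, Y) when Y = X. *)
Definition fdistdiag (R : realType) (X : finType) (P : fdist R X) :
    fdist R (X * X)%type := fdistmap P (fun x => (x, x)).

(* The joint laws Q of (X, Xhat) with X ~ P and I(X; Xhat) <= delta. *)
Definition feasible_joint (R : realType) (X Xhat : finType) (P : fdist R X)
    (delta : R) : set (fdist R (X * Xhat)%type) :=
  [set Q | fdistmap Q fst =1 P /\ mutual_info Q fst snd <= delta].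

Definition is_minimum (d : Order.disp_t) (T : porderType d) (S : set T) (m : T) :
    Prop := S m /\ lbound S m.

(* Main.v *)
(* The key is the Donsker-Varadhan bound: for a joint law J with
   marginals J1, J2 and h >= 0 positive on the support of J,
   E_J[ln h] + 1 - E_(J1 x J2)[h] <= I(J), with equality in the limit over h.
   Converse: from an encoder with joint law J of (X^n, Xhat^n), let Q be the
   average over i of the laws of (X_i, Xhat_i); it has the same cost, and taking
   for h the product over i of the information density of Q at (x_i, xhat_i)
   gives n I(Q) <= I(J) at once.
   Achievability: the n-fold product of a feasible Q has information n I(Q);
   disintegrating it along X^n yields the encoder.
   The minimum is attained because the bound describes the feasible set by
   linear inequalities, so that it is a closed subset of a cube. *)

Require Import Defs.
From HB Require Import structures.
From mathcomp Require Import all_boot all_order all_algebra.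
From mathcomp Require Import all_classical all_reals all_analysis.
From mathcomp Require Import ring lra.

Set Implicit Arguments.
Unset Strict Implicit.
Unset Printing Implicit Defensive.

Import Order.TTheory GRing.Theory Num.Theory numFieldNormedType.Exports.
Local Open Scope ring_scope.
Local Open Scope classical_set_scope.

(** * Expectations and laws on finite sets *)

Section Expectation.
Context {R : realType}.
Implicit Types A B W : finType.

Lemma fdist_ext A (P Q : fdist R A) : P =1 Q -> P = Q.
Proof.
case: P Q => p p0 p1 [q q0 q1] /= /funext pq; subst q.
by congr FDist; exact: Prop_irrelevance.
Qed.

Lemma expect_fdistmap W A (P : fdist R W) (U : W -> A) (g : A -> R) :
  expect (fdistmap P U) g = expect P (g \o U).
Proof.
rewrite /expect [RHS](partition_big U predT) //=; apply: eq_bigr => a _.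
by rewrite mulr_suml; apply: eq_bigr => w /eqP <-.
Qed.

Lemma pmf_expect A (P : fdist R A) a :
  P a = expect P (fun b => (b == a)%:R).
Proof.
rewrite /expect (bigD1 a) //= eqxx mulr1 big1 ?addr0 // => b /negbTE ->.
by rewrite mulr0.
Qed.

(** Point masses are expectations of indicators; identities between laws thus reduce to changes of
    variables. *)
Lemma fdist_ext_expect A (P Q : fdist R A) :
  (forall g, expect P g = expect Q g) -> P = Q.
Proof. by move=> PQ; apply: fdist_ext => a; rewrite !pmf_expect. Qed.

Lemma fdistmap_comp W A B (P : fdist R W) (U : W -> A) (V : A -> B) :
  fdistmap (fdistmap P U) V = fdistmap P (V \o U).
Proof. by apply: fdist_ext_expect => g; rewrite !expect_fdistmap. Qed.

Lemma expect_fdistjoint A B (P : fdist R A) (K : A -> fdist R B) g :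
  expect (fdistjoint P K) g = expect P (fun a => expect (K a) (fun b => g (a, b))).
Proof.
rewrite /expect; under [RHS]eq_bigr do rewrite mulr_sumr.
by rewrite pair_bigA /=; apply: eq_bigr => -[a b] _ /=; rewrite mulrA.
Qed.

Lemma fdistjoint_fst A B (P : fdist R A) (K : A -> fdist R B) :
  fdistmap (fdistjoint P K) fst = P.
Proof.
apply: fdist_ext_expect => g; rewrite expect_fdistmap expect_fdistjoint.
by apply: eq_bigr => a _ /=; rewrite /expect -mulr_suml Defs.pmf_sum1 mul1r.
Qed.

(** Points of mass zero contribute nothing, so logarithms may be expanded on the support alone,
    where their arguments are positive. *)
Lemma eq_expect W (P : fdist R W) (g h : W -> R) :
  (forall w, 0 < P w -> g w = h w) -> expect P g = expect P h.
Proof.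
move=> gh; apply: eq_bigr => w _; have := Defs.pmf_ge0 P w.
by rewrite le_eqVlt => /predU1P[<-|/gh->//]; rewrite !mul0r.
Qed.

Lemma expect_ge0 W (P : fdist R W) (g : W -> R) :
  (forall w, 0 <= g w) -> 0 <= expect P g.
Proof. by move=> g0; apply: sumr_ge0 => w _; rewrite mulr_ge0 ?Defs.pmf_ge0. Qed.

Lemma expect_sum W I (r : seq I) (P : fdist R W) (g : I -> W -> R) :
  expect P (fun w => \sum_(i <- r) g i w) = \sum_(i <- r) expect P (g i).
Proof.
rewrite /expect [RHS]exchange_big /=; apply: eq_bigr => w _.
by rewrite mulr_sumr.
Qed.

Lemma expectZ W (P : fdist R W) (k : R) (g : W -> R) :
  expect P (fun w => k * g w) = k * expect P g.
Proof. by rewrite /expect mulr_sumr; apply: eq_bigr => w _; rewrite mulrCA. Qed.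

Lemma fdistmap_gt0 W A (P : fdist R W) (U : W -> A) w :
  0 < P w -> 0 < fdistmap P U (U w).
Proof.
move=> Pw; rewrite /= (bigD1 w) //= ltr_wpDr ?sumr_ge0// => *.
exact: Defs.pmf_ge0.
Qed.

(** Expanding the product of fibre sums gives a sum over all [x] with each [x i] in the fibre above
    [y i]. *)
Lemma fdistiid_map W A (P : fdist R W) (U : W -> A) n :
  fdistiid (fdistmap P U) n = fdistmap (fdistiid P n) (fun x => [ffun i => U (x i)]).
Proof.
apply: fdist_ext => y /=; rewrite bigA_distr_big_dep /=.
apply: eq_bigl => x; apply/familyP/eqP => [xy|<- i]; last first.
  by rewrite unfold_in ffunE.
by apply/ffunP => i; rewrite ffunE; apply/eqP; exact: xy.
Qed.

Lemma fdistiid_marginal A (P : fdist R A) n (i : 'I_n) :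
  fdistmap (fdistiid P n) (fun x => x i) = P.
Proof.
apply: fdist_ext => a /=.
(* The event that coordinate [i] equals [a] is the product of the sets [Q j], so its mass factors
   over the coordinates. *)
pose Q j := if j == i then pred1 a else predT.
rewrite (eq_bigl (fun x => x \in family Q)) => [|x]; last first.
  apply/eqP/familyP => [xa j|/(_ i)]; last by rewrite /Q eqxx => /eqP.
  by rewrite /Q; case: eqP => // ->; exact/eqP.
rewrite -(bigA_distr_big_dep Q (fun _ b => P b)) (bigD1 i) //=.
rewrite /Q eqxx big_pred1_eq big1 ?mulr1 // => j /negbTE ->.
exact: Defs.pmf_sum1.
Qed.

Lemma expect_fdistiid_sum A (P : fdist R A) n (g : A -> R) :
  expect (fdistiid P n) (fun x => \sum_(i < n) g (x i)) = n%:R * expect P g.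
Proof.
rewrite expect_sum; under eq_bigr => i _.
  rewrite -(expect_fdistmap (fdistiid P n) (fun x => x i)) fdistiid_marginal.
  over.
by rewrite sumr_const card_ord mulr_natl.
Qed.

Lemma fdistiid_gt0 A (P : fdist R A) n (x : {ffun 'I_n -> A}) :
  0 < fdistiid P n x -> forall i, 0 < P (x i).
Proof.
move=> /= Px i; rewrite lt0r Defs.pmf_ge0 andbT; apply: contraTneq Px => Pxi.
by rewrite (bigD1 i) //= Pxi mul0r ltxx.
Qed.

Lemma disintegration A B (J : fdist R (A * B)%type) : (0 < #|B|)%N ->
  exists K, J = fdistjoint (fdistmap J fst) K.
Proof.
move=> /card_gt0P[b0 _]; pose PA := fdistmap J fst.
have PAE a : PA a = \sum_b J (a, b).
  transitivity (\sum_(a' | a' == a) \sum_b J (a', b)); last by rewrite big_pred1_eq.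
  rewrite pair_big_dep /=.
  by apply: eq_big => -[a' b] //=; rewrite andbT.
suff /choice[K KE] : forall a, exists k : fdist R B, forall b, J (a, b) = PA a * k b.
  by exists K; apply: fdist_ext => -[a b]; rewrite /= -KE.
move=> a; have [Pa0|Pa0] := eqVneq (PA a) 0.
  (* Above a null [a] all the masses [J (a, b)] vanish, so any conditional law will do; this one is
     the point mass at [b0]. *)
  exists (fdistmap J (fun=> b0)) => b; rewrite Pa0 mul0r; apply/eqP.
  move/eqP: Pa0; rewrite PAE psumr_eq0 => [|? _].
    by move=> /allP/(_ b (mem_index_enum b))/implyP/(_ isT).
  exact: Defs.pmf_ge0.
have k0 b : 0 <= J (a, b) / PA a by rewrite divr_ge0 ?Defs.pmf_ge0.
have k1 : \sum_b J (a, b) / PA a = 1 by rewrite -mulr_suml -PAE divff.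
by exists (FDist k0 k1) => b /=; rewrite mulrC divfK.
Qed.

End Expectation.

(** * Information density and the Donsker-Varadhan bound *)

Section MutualInformation.
Context {R : realType}.
Implicit Types A B W : finType.

Lemma expect_swap A B (P : fdist R A) (Q : fdist R B) (g : A -> B -> R) :
  expect P (fun a => expect Q (g a)) = expect Q (fun b => expect P (g^~ b)).
Proof.
rewrite /expect; under eq_bigr do rewrite mulr_sumr.
rewrite exchange_big /=; apply: eq_bigr => b _; rewrite mulr_sumr.
by apply: eq_bigr => a _; rewrite mulrCA.
Qed.

Lemma expect_le W (P : fdist R W) (k : R) (g : W -> R) :
  (forall w, g w <= k) -> expect P g <= k.
Proof.
move=> gk; rewrite -[k]mulr1 -(Defs.pmf_sum1 P) mulr_sumr; apply: ler_sum => w _.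
by rewrite mulrC ler_wpM2r ?Defs.pmf_ge0.
Qed.

Lemma expect_fdistiid_prod A (P : fdist R A) n (g : 'I_n -> A -> R) :
  expect (fdistiid P n) (fun x => \prod_(i < n) g i (x i)) =
  \prod_(i < n) expect P (g i).
Proof.
rewrite bigA_distr_bigA; apply: eq_bigr => x _ /=.
by rewrite -big_split.
Qed.

Lemma fdistmap_inj W A (P : fdist R W) (U : W -> A) w :
  injective U -> fdistmap P U (U w) = P w.
Proof.
move=> injU; rewrite /= (eq_bigl (pred1 w)) ?big_pred1_eq// => v.
exact: inj_eq.
Qed.

Lemma ln_prod I (r : seq I) (F : I -> R) : (forall i, 0 < F i) ->
  ln (\prod_(i <- r) F i) = \sum_(i <- r) ln (F i).
Proof.
move=> F0; elim: r => [|i r IH]; first by rewrite !big_nil ln1.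
by rewrite !big_cons lnM ?IH// posrE// prodr_gt0.
Qed.

(* The Radon-Nikodym derivative of a joint law with respect to the product of
   its marginals, with value 0 outside the support of that product. *)
Definition info_density A B (Q : fdist R (A * B)%type) (w : A * B) : R :=
  Q w / (fdistmap Q fst w.1 * fdistmap Q snd w.2).

Lemma info_density_ge0 A B (Q : fdist R (A * B)%type) w : 0 <= info_density Q w.
Proof. by rewrite divr_ge0 ?mulr_ge0 ?Defs.pmf_ge0. Qed.

Lemma info_density_gt0 A B (Q : fdist R (A * B)%type) w :
  0 < Q w -> 0 < info_density Q w.
Proof.
by move=> Qw; rewrite divr_gt0// mulr_gt0//; exact: fdistmap_gt0.
Qed.

Lemma mutual_info_density A B (Q : fdist R (A * B)%type) :
  mutual_info Q fst snd = expect Q (fun w => ln (info_density Q w)).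
Proof.
rewrite /mutual_info (_ : fdistmap Q _ = Q) //.
apply: fdist_ext_expect => g; rewrite expect_fdistmap.
by apply: eq_bigr => -[].
Qed.

(** Information depends only on the joint law, so every computation can take place on [A * B] with
    the two projections. *)
Lemma mutual_info_pair W A B (P : fdist R W) (U : W -> A) (V : W -> B) :
  mutual_info P U V = mutual_info (fdistmap P (fun w => (U w, V w))) fst snd.
Proof.
by rewrite mutual_info_density /mutual_info /info_density !fdistmap_comp.
Qed.

(** If [b] has positive mass, the terms are bounded by the conditional law given [b], of total mass
    1. If [b] is null, the density is 0 by the convention on division by zero, hence an
    inequality. *)
Lemma expect_info_density_le1 A B (Q : fdist R (A * B)%type) b :
  expect (fdistmap Q fst) (fun a => info_density Q (a, b)) <= 1.
Proof.
have [Qb|Qb] := eqVneq (fdistmap Q snd b) 0.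
  rewrite /expect big1 ?ler01// => a _.
  by rewrite /info_density Qb mulr0 invr0 !mulr0.
apply: (@le_trans _ _ (\sum_a Q (a, b) / fdistmap Q snd b)).
  apply: ler_sum => a _; rewrite /info_density /=.
  have [->|Qa] := eqVneq (\sum_(w | w.1 == a) Q w) 0.
    by rewrite mul0r divr_ge0 ?sumr_ge0 // => *; exact: Defs.pmf_ge0.
  by rewrite invfM mulrCA mulVKf.
rewrite -mulr_suml (_ : \sum_a _ = fdistmap Q snd b) ?divff//.
transitivity (\sum_a \sum_(b' | b' == b) Q (a, b')).
  by apply: eq_bigr => a _; rewrite big_pred1_eq.
by rewrite pair_big_dep /=; apply: eq_big => -[].
Qed.

(* Donsker-Varadhan: in the form stated here (with [h] for the exponential of
   the test function) the left-hand side is affine in [Q] once the first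
   marginal is fixed, which makes the feasible set closed. *)
Lemma mutual_info_ge A B (Q : fdist R (A * B)%type) (h : A * B -> R) :
  (forall w, 0 <= h w) -> (forall w, 0 < Q w -> 0 < h w) ->
  expect Q (fun w => ln (h w)) + 1 -
    expect (fdistmap Q fst) (fun a => expect (fdistmap Q snd) (fun b => h (a, b)))
  <= mutual_info Q fst snd.
Proof.
move=> h0 hQ; rewrite mutual_info_density -(Defs.pmf_sum1 Q) {2}/expect.
under [X in _ - X]eq_bigr do rewrite /expect mulr_sumr.
rewrite pair_bigA /= -big_split -sumrB /=; apply: ler_sum => -[a b] _ /=.
have := Defs.pmf_ge0 Q (a, b); rewrite le_eqVlt => /predU1P[<-|Qw].
  rewrite !mul0r add0r sub0r oppr_le0 mulr_ge0 ?(mulr_ge0, h0)//.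
    exact: (Defs.pmf_ge0 (fdistmap Q fst)).
  exact: (Defs.pmf_ge0 (fdistmap Q snd)).
have hw := hQ _ Qw; rewrite /info_density /=.
have := fdistmap_gt0 fst Qw; have := fdistmap_gt0 snd Qw => /=.
set mb := \sum_(w | _) _; set ma := \sum_(w | _) _ => mb0 ma0.
set q := Q (a, b) in Qw *; set k := h (a, b) in hw *.
(* With [r] the ratio of the information density to [h], the termwise inequality becomes
   [1 - r^-1 <= ln r]. *)
pose r := (q / (ma * mb)) / k.
have r0 : 0 < r by rewrite !divr_gt0 ?mulr_gt0.
have -> : q / (ma * mb) = k * r by rewrite [RHS]mulrC divfK// gt_eqF.
have -> : ma * (mb * k) = q * r^-1.
  by rewrite /r !invfM !invrK; field; rewrite gt_eqF.
rewrite lnM ?posrE // mulrDr -addrA lerD2l -{1}[q]mulr1 -mulrBr ler_pM2l//.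
rewrite -lerN2 -lnV ?posrE// opprB.
have := @le_ln1Dx R (r^-1 - 1); rewrite (addrC 1) subrK; apply.
by rewrite ltrBrDl subrr invr_gt0.
Qed.

Lemma mutual_info_le A B (Q : fdist R (A * B)%type) (delta : R) :
  (forall h, (forall w, 0 < h w) -> expect Q (fun w => ln (h w)) + 1 -
    expect (fdistmap Q fst) (fun a => expect (fdistmap Q snd) (fun b => h (a, b)))
    <= delta) ->
  mutual_info Q fst snd <= delta.
Proof.
move=> Qdelta; apply/ler_addgt0Pr => t t0.
(* The information density would give equality but vanishes off the support of [Q]; the value [t]
   there makes [h] positive and adds at most [t] to the product expectation. *)
pose h w := if 0 < Q w then info_density Q w else t.
have h0 w : 0 < h w by rewrite /h; case: ifPn => // ?; exact: info_density_gt0.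
have := Qdelta h h0.
have -> : expect Q (fun w => ln (h w)) = mutual_info Q fst snd.
  by rewrite mutual_info_density; apply: eq_expect => w Qw; rewrite /h Qw.
suff : expect (fdistmap Q fst)
    (fun a => expect (fdistmap Q snd) (fun b => h (a, b))) <= 1 + t by lra.
rewrite expect_swap.
have hle w : h w <= info_density Q w + t.
  by rewrite /h; case: ifP => _; rewrite (lerDl, lerDr) ?info_density_ge0// ltW.
apply: expect_le => b.
have := expect_info_density_le1 Q b; rewrite -(lerD2r t); apply: le_trans.
rewrite -[X in _ + X](mulr1 t) -(Defs.pmf_sum1 (fdistmap Q fst)) mulr_sumr /expect.
rewrite -big_split; apply: ler_sum => a _ /=; rewrite [t * _]mulrC -mulrDr.
by rewrite ler_wpM2l// (Defs.pmf_ge0 (fdistmap Q fst)).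
Qed.

End MutualInformation.

(** * Product laws of pairs of letters *)

Section SingleLetter.
Context {R : realType} {A B : finType}.

Definition unzip n (s : {ffun 'I_n -> (A * B)%type}) :
    ({ffun 'I_n -> A} * {ffun 'I_n -> B})%type :=
  ([ffun i => (s i).1], [ffun i => (s i).2]).

Lemma unzip_inj n : injective (@unzip n).
Proof.
move=> s t [/ffunP s1 /ffunP s2]; apply/ffunP => i.
by move: (s1 i) (s2 i); rewrite !ffunE; case: (s i) (t i) => [? ?] [? ?] /= -> ->.
Qed.

(** A sequence of independent pairs, seen as a pair of sequences. *)
Definition zip_law (Q : fdist R (A * B)%type) n := fdistmap (fdistiid Q n) (@unzip n).

Lemma zip_law_fst (Q : fdist R (A * B)%type) n :
  fdistmap (zip_law Q n) fst = fdistiid (fdistmap Q fst) n.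
Proof. by rewrite fdistmap_comp fdistiid_map. Qed.

Lemma zip_law_snd (Q : fdist R (A * B)%type) n :
  fdistmap (zip_law Q n) snd = fdistiid (fdistmap Q snd) n.
Proof. by rewrite fdistmap_comp fdistiid_map. Qed.

(** The marginals are product laws and [unzip] is injective, so the information density is a product
    over letters and its logarithm a sum. *)
Lemma mutual_info_zip_law (Q : fdist R (A * B)%type) n :
  mutual_info (zip_law Q n) fst snd = n%:R * mutual_info Q fst snd.
Proof.
rewrite !mutual_info_density -expect_fdistiid_sum expect_fdistmap.
apply: eq_expect => s Qs; rewrite /= /info_density zip_law_fst zip_law_snd.
rewrite (fdistmap_inj _ _ (@unzip_inj n)) /= -big_split -prodfV -big_split /=.
under eq_bigr do rewrite !ffunE.
rewrite (_ : \prod_i _ = \prod_(i < n) info_density Q (s i)) //.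
by apply: ln_prod => i; apply/info_density_gt0/fdistiid_gt0.
Qed.

Lemma expect_additive_cost_zip_law (Q : fdist R (A * B)%type) n
    (c : A -> B -> R) : (0 < n)%N ->
  expect (zip_law Q n) (fun w => additive_cost c w.1 w.2) =
  expect Q (fun w => c w.1 w.2).
Proof.
move=> n0; have n0' : n%:R != 0 :> R by rewrite pnatr_eq0 -lt0n.
rewrite expect_fdistmap /additive_cost expectZ.
apply: (mulfI n0'); rewrite mulVKf// -expect_fdistiid_sum.
by apply: eq_expect => s _; apply: eq_bigr => i _; rewrite !ffunE.
Qed.

End SingleLetter.

(** * Averages of finitely many laws *)

Section Mean.
Context {R : realType} {A : finType} {n : nat} (n_gt0 : (0 < n)%N).
Variable F : 'I_n -> fdist R A.

Let n_neq0 : n%:R != 0 :> R. Proof. by rewrite pnatr_eq0 -lt0n. Qed.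

Lemma fdistmean_ge0 a : 0 <= n%:R^-1 * \sum_(i < n) F i a.
Proof. by rewrite mulr_ge0 ?invr_ge0 ?sumr_ge0// => i _; exact: Defs.pmf_ge0. Qed.

Lemma fdistmean_sum1 : \sum_a n%:R^-1 * \sum_(i < n) F i a = 1.
Proof.
rewrite -mulr_sumr exchange_big /=.
under eq_bigr do rewrite Defs.pmf_sum1.
by rewrite sumr_const card_ord mulVf.
Qed.

Definition fdistmean : fdist R A := FDist fdistmean_ge0 fdistmean_sum1.

Lemma expect_fdistmean g :
  n%:R * expect fdistmean g = \sum_(i < n) expect (F i) g.
Proof.
rewrite /expect /= mulr_sumr exchange_big /=; apply: eq_bigr => a _.
by rewrite -mulrA mulVKf// mulr_suml.
Qed.

(** Keeps the information density of the average positive on the support of each averaged law. *)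
Lemma fdistmean_gt0 i a : 0 < F i a -> 0 < fdistmean a.
Proof.
move=> Fia; rewrite mulr_gt0// ?invr_gt0 ?ltr0n// (bigD1 i)//=.
by rewrite ltr_wpDr// sumr_ge0// => *; exact: Defs.pmf_ge0.
Qed.

End Mean.

(** * Converse: from sequences to a single letter *)

Section Converse.
Context {R : realType} {A B : finType} {n : nat} (n_gt0 : (0 < n)%N).
Variables (P : fdist R A) (J : fdist R ({ffun 'I_n -> A} * {ffun 'I_n -> B})%type).
Hypothesis J_fst : fdistmap J fst = fdistiid P n.

Definition letter_law (i : 'I_n) : fdist R (A * B)%type :=
  fdistmap J (fun w => (w.1 i, w.2 i)).

Definition mean_letter_law := fdistmean n_gt0 letter_law.
Local Notation Q := mean_letter_law.

Let n_neq0 : n%:R != 0 :> R. Proof. by rewrite pnatr_eq0 -lt0n. Qed.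

Lemma expect_mean_letter_law g :
  n%:R * expect Q g = expect J (fun w => \sum_(i < n) g (w.1 i, w.2 i)).
Proof.
rewrite expect_fdistmean expect_sum.
by apply: eq_bigr => i _; rewrite expect_fdistmap.
Qed.

(** Each letter of the first sequence has law [P], and averaging copies of [P] gives [P]. *)
Lemma mean_letter_law_fst : fdistmap Q fst = P.
Proof.
apply: fdist_ext_expect => g; apply: (mulfI n_neq0).
rewrite expect_fdistmap expect_mean_letter_law -expect_fdistiid_sum -J_fst.
by rewrite expect_fdistmap.
Qed.

Lemma expect_cost_mean_letter_law (c : A -> B -> R) :
  expect Q (fun w => c w.1 w.2) = expect J (fun w => additive_cost c w.1 w.2).
Proof.
apply: (mulfI n_neq0); rewrite expect_mean_letter_law /additive_cost expectZ.
by rewrite mulVKf.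
Qed.

(* The test function in the Donsker-Varadhan bound is the sum of the
   single-letter information densities. *)
Lemma mutual_info_mean_letter_law :
  n%:R * mutual_info Q fst snd <= mutual_info J fst snd.
Proof.
have Jpos w : 0 < J w -> forall i, 0 < info_density Q (w.1 i, w.2 i).
  move=> Jw i; apply/info_density_gt0/(@fdistmean_gt0 _ _ _ _ _ i).
  exact: (@fdistmap_gt0 _ _ _ J (fun w => (w.1 i, w.2 i)) w Jw).
pose h (w : {ffun 'I_n -> A} * {ffun 'I_n -> B}) :=
  \prod_(i < n) info_density Q (w.1 i, w.2 i).
have h0 w : 0 <= h w by apply: prodr_ge0 => i _; exact: info_density_ge0.
have hJ w : 0 < J w -> 0 < h w by move=> Jw; apply: prodr_gt0 => i _; exact: Jpos.
apply: le_trans (mutual_info_ge h0 hJ).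
rewrite mutual_info_density expect_mean_letter_law -addrA.
rewrite (_ : expect J _ = expect J (fun w => ln (h w))); last first.
  by apply: eq_expect => w Jw; rewrite ln_prod// => i; exact: Jpos.
(* It remains to bound the product expectation of [h] by 1. For fixed [y], independence of the
   source letters factors it into [n] expectations, each at most 1. *)
rewrite lerDl subr_ge0 expect_swap; apply: expect_le => y.
rewrite J_fst (expect_fdistiid_prod P (fun i a => info_density Q (a, y i))).
apply: prodr_ile1 => i _; rewrite -{1 2}mean_letter_law_fst.
rewrite expect_ge0 => [|a]; last exact: info_density_ge0.
exact: expect_info_density_le1.
Qed.

End Converse.

(** * Compactness of the feasible set *)

Lemma sum_continuous {R : realType} {T : topologicalType} I (r : seq I)
    (F : I -> T -> R) :
  (forall i, continuous (F i)) -> continuous (fun x => \sum_(i <- r) F i x).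
Proof.
move=> cF x; elim: r => [|i r IH].
  rewrite (_ : (fun _ => _) = cst 0); first exact: cst_continuous.
  by apply/funext => y; rewrite big_nil.
rewrite (_ : (fun _ => _) = (F i \+ (fun y => \sum_(j <- r) F j y))).
  by apply: cvgD; [exact: cF|exact: IH].
by apply/funext => y; rewrite big_cons.
Qed.

Section Minimum.
Context {R : realType} {A B : finType}.

(** Laws are treated as points of a finite-dimensional space with the product topology, where
    [form k] is the linear form with coefficients [k]. *)
Let V := prod_topology (fun _ : (A * B)%type => R).
Let form (k : A * B -> R) (q : V) : R := \sum_w q w * k w.

Lemma continuous_form k : continuous (form k).
Proof.
apply: sum_continuous => w q.
have proj_w : continuous (fun q : V => q w) by exact: (@proj_continuous _ (fun=> R) w).
apply: (@cvgM R V (nbhs q) _ (fun q : V => q w) (cst (k w)) (q w) (k w) (proj_w q)).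
exact: cst_continuous.
Qed.

Lemma closed_form_le k r : closed [set q | form k q <= r].
Proof.
apply: (@preimage_closed _ _ (form k) _ _ (@closed_le _ r)) => q _.
exact: continuous_form.
Qed.

Lemma closed_form_eq k r : closed [set q | form k q = r].
Proof.
apply: (@preimage_closed _ _ (form k) _ _ (@closed_eq _ r)) => q _.
exact: continuous_form.
Qed.

Variables (P : fdist R A) (delta : R).

(** The last family is the Donsker-Varadhan inequalities with the first marginal frozen to [P],
    which makes them linear in [q]; the constant 1 of the bound is moved into [delta - 1]. *)
Let feasible_fct : set V :=
  [set q | forall w, `[0, 1] (q w)] `&`
  \bigcap_a [set q | form (fun w => (w.1 == a)%:R) q = P a] `&`
  \bigcap_(h in [set h : A * B -> R | forall w, 0 < h w])
     [set q | form (fun w => ln (h w) - expect P (fun a => h (a, w.2))) q <= delta - 1].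

Lemma compact_feasible_fct : compact feasible_fct.
Proof.
have cube : compact [set q : V | forall w, `[0, 1] (q w)].
  apply: (@tychonoff (A * B)%type (fun=> R) (fun=> `[0, 1]%classic)) => w.
  exact: segment_compact.
rewrite /feasible_fct -setIA; apply: compact_closedI => //.
apply: closedI; apply: closed_bigI => ? _; first exact: closed_form_eq.
exact: closed_form_le.
Qed.

(** Donsker-Varadhan gives the linear constraints from the information bound; conversely, positive
    test functions suffice to recover that bound. *)
Lemma feasible_jointP (Q : fdist R (A * B)%type) :
  feasible_joint P delta Q <-> feasible_fct (Q : _ -> _).
Proof.
have Q01 w : `[0, 1] (Q w).
  rewrite /= in_itv /= Defs.pmf_ge0 -(Defs.pmf_sum1 Q) (bigD1 w)//= lerDl.
  by apply: sumr_ge0 => *; exact: Defs.pmf_ge0.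
have formE k : form k Q = expect Q k by [].
have Q1 a : form (fun w => (w.1 == a)%:R) Q = fdistmap Q fst a.
  by rewrite pmf_expect expect_fdistmap.
have dvE h : fdistmap Q fst = P ->
    form (fun w => ln (h w) - expect P (fun a => h (a, w.2))) Q =
    expect Q (fun w => ln (h w)) -
    expect (fdistmap Q fst) (fun a => expect (fdistmap Q snd) (fun b => h (a, b))).
  move=> ->; rewrite expect_swap expect_fdistmap /form /expect -sumrB.
  by apply: eq_bigr => w _; rewrite mulrBr.
split=> [[QP Qdelta]|[[_ QP] Qdelta]].
  split; first by split => // a _; exact: (etrans (Q1 a) (QP a)).
  move=> h h0; apply: (@le_trans _ _ (mutual_info Q fst snd - 1)); last by rewrite lerB.
  rewrite [leLHS]dvE; last exact: fdist_ext.
  by rewrite lerBrDr addrAC; apply: mutual_info_ge => w *; rewrite ?ltW ?h0.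
have {}QP : fdistmap Q fst =1 P by move=> a; rewrite -Q1; exact: QP.
split => //; apply: mutual_info_le => h h0; rewrite addrAC -lerBrDr -dvE.
  exact: Qdelta.
exact: fdist_ext.
Qed.

Lemma feasible_joint_argmin (g : A * B -> R) :
  feasible_joint (Xhat := B) P delta !=set0 ->
  exists2 Q : fdist R (A * B)%type, feasible_joint P delta Q &
    forall Q' : fdist R (A * B)%type, feasible_joint P delta Q' ->
      expect Q g <= expect Q' g.
Proof.
move=> [Q0 /feasible_jointP FQ0].
have [] := @compact_EVT_min _ _ (form g) feasible_fct _ compact_feasible_fct.
- by exists (Q0 : _ -> _).
- exact/continuous_subspaceT/continuous_form.
move=> q /set_mem qF qmin.
have q0 w : 0 <= q w by case: qF => -[/(_ w)/=]; rewrite in_itv => /andP[].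
(* Total mass one comes from summing the marginal constraints over [a]. *)
have q1 : \sum_w q w = 1.
  case: qF => -[_ qP] _; rewrite -(Defs.pmf_sum1 P).
  under [RHS]eq_bigr => a _ do rewrite -(qP a I).
  rewrite exchange_big /=; apply: eq_bigr => w _.
  rewrite -mulr_sumr (bigD1 w.1)//= eqxx big1 ?addr0 ?mulr1// => a.
  by rewrite eq_sym => /negbTE ->.
exists (FDist q0 q1); first exact/feasible_jointP.
by move=> Q' /feasible_jointP FQ'; apply: qmin; exact/mem_set.
Qed.

End Minimum.

(** * Reduction of the source pair to the case Y = X *)

Lemma expect_diag {R : realType} {A B : finType} (P : fdist R A) n (f : encoder R A B n)
    (g : {ffun 'I_n -> A} -> {ffun 'I_n -> A} -> {ffun 'I_n -> B} -> R) :
  expect (fdistjoint (fdistiid (fdistdiag P) n) (fun s => f [ffun i => (s i).1]))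
    (fun w => g [ffun i => (w.1 i).1] [ffun i => (w.1 i).2] w.2) =
  expect (fdistjoint (fdistiid P n) f) (fun w => g w.1 w.1 w.2).
Proof.
(* The diagonal source is the image of the source [P] under duplication of letters, so both
   component sequences equal [x]. *)
rewrite !expect_fdistjoint fdistiid_map expect_fdistmap.
apply: eq_expect => x _ /=.
have ffunK (u : 'I_n -> A) : (forall i, u i = x i) -> [ffun i => u i] = x.
  by move=> ux; apply/ffunP => i; rewrite ffunE.
by rewrite !ffunK// => i; rewrite ffunE.
Qed.

(** The diagonal identity for arbitrary test functions equates the joint laws, hence the
    informations; for the cost function it equates the costs. *)
Lemma avg_strongly_achievable_diag {R : realType} {A B : finType} (P : fdist R A)
    (c : A -> B -> R) n eps Gamma :
  avg_strongly_achievable (fdistdiag P) c n eps Gamma <->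
  exists f : encoder R A B n, let J := fdistjoint (fdistiid P n) f in
    mutual_info J fst snd <= eps /\
    expect J (fun w => additive_cost c w.1 w.2) <= Gamma.
Proof.
have E f :
    let J := fdistjoint (fdistiid (fdistdiag P) n) (fun s => f [ffun i => (s i).1]) in
    (mutual_info J (fun w => [ffun i => (w.1 i).2]) snd =
     mutual_info (fdistjoint (fdistiid P n) f) fst snd) *
    (expect J (fun w => additive_cost c [ffun i => (w.1 i).1] w.2) =
     expect (fdistjoint (fdistiid P n) f) (fun w => additive_cost c w.1 w.2)).
  split; last exact: (expect_diag P f (fun x _ y => additive_cost c x y)).
  rewrite mutual_info_pair; congr (mutual_info _ _ _).
  apply: fdist_ext_expect => g; rewrite expect_fdistmap.
  rewrite [LHS](expect_diag P f (fun _ x y => g (x, y))).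
  by apply: eq_expect => -[].
by split=> -[f If]; exists f; move: If; rewrite /= !E.
Qed.

(** * Feasibility and the minimum formula *)

Lemma feasible_joint_nonempty {R : realType} {A B : finType} (P : fdist R A)
    (delta : R) : (0 < #|B|)%N -> 0 <= delta ->
  feasible_joint (Xhat := B) P delta !=set0.
Proof.
move=> /card_gt0P[b0 _] delta0.
(* Point mass at [b0]: a constant reproduction is independent of the source, so its information
   density is 1 on the support. *)
pose D : fdist R B := fdistmap P (fun=> b0).
exists (fdistjoint P (fun=> D)); split; first by rewrite fdistjoint_fst.
rewrite mutual_info_density /expect big1// => -[a b] _.
have DE : fdistmap (fdistjoint P (fun=> D)) snd = D.
  apply: fdist_ext_expect => g; rewrite expect_fdistmap expect_fdistjoint /=.
  by rewrite {1}/expect -mulr_suml Defs.pmf_sum1 mul1r.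
have [->|p0] := eqVneq (fdistjoint P (fun=> D) (a, b)) 0; first by rewrite mul0r.
by rewrite /info_density fdistjoint_fst DE divff// ln1 mulr0.
Qed.

Theorem corollary5 (R : realType) (X Xhat : finType)
    (hX : (0 < #|X|)%N) (hXhat : (0 < #|Xhat|)%N)
    (P : fdist R X) (c : X -> Xhat -> R) (hc : forall x xh, 0 <= c x xh)
    (n : nat) (hn : (1 <= n)%N) (eps : R) (heps : 0 <= eps) :
  is_minimum
    [set (expect Q (fun w => c w.1 w.2))%:E
      | Q in feasible_joint (Xhat := Xhat) P (eps / n%:R)]
    (Ca_star (fdistdiag P) c n eps).
Proof.
have n0 : 0 < n%:R :> R by rewrite ltr0n.
have eps0 : 0 <= eps / n%:R by rewrite divr_ge0// ltW.
pose cost (Q : fdist R (X * Xhat)%type) := expect Q (fun w => c w.1 w.2).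
have achievable Q : feasible_joint P (eps / n%:R) Q ->
    avg_strongly_achievable (fdistdiag P) c n eps (cost Q).
  move=> [/fdist_ext QP Qeps]; apply/avg_strongly_achievable_diag.
  have Bn : (0 < #|{: {ffun 'I_n -> Xhat}}|)%N by rewrite card_ffun expn_gt0 hXhat.
  have [f] := disintegration (zip_law Q n) Bn.
  rewrite zip_law_fst QP => JE; exists f; rewrite -JE; split.
    by rewrite mutual_info_zip_law mulrC -ler_pdivlMr.
  by rewrite expect_additive_cost_zip_law.
have converse Gamma : avg_strongly_achievable (fdistdiag P) c n eps Gamma ->
    exists2 Q, feasible_joint P (eps / n%:R) Q & cost Q <= Gamma.
  move=> /avg_strongly_achievable_diag[f [/= Jeps Jcost]].
  have Jfst := fdistjoint_fst (fdistiid P n) f.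
  exists (mean_letter_law hn (fdistjoint (fdistiid P n) f)).
    split; first by rewrite (mean_letter_law_fst hn Jfst).
    rewrite ler_pdivlMr// mulrC; apply: le_trans Jeps.
    exact: (mutual_info_mean_letter_law hn Jfst).
  by rewrite /cost expect_cost_mean_letter_law.
have [Q Qfeas Qmin] := feasible_joint_argmin (fun w => c w.1 w.2)
  (feasible_joint_nonempty P hXhat eps0).
(* The cost of the minimizer [Q] is itself an achievable level, and any achievable [Gamma] dominates
   the cost of some feasible law. *)
have -> : Ca_star (fdistdiag P) c n eps = (cost Q)%:E.
  apply/eqP; rewrite eq_le; apply/andP; split.
    apply: ereal_inf_lbound; exists (cost Q) => //; split; last exact: achievable.
    by apply: expect_ge0 => w; exact: hc.
  apply/ereal_infP => _ [Gamma [_ /converse[Q' Q'feas Q'Gamma]] <-].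
  by rewrite lee_fin (le_trans _ Q'Gamma)//; exact: Qmin.
split; first by exists Q.
by move=> _ [Q' Q'feas <-]; rewrite lee_fin; exact: Qmin.
Qed.
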